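(* Let $d\ge 1$ and let $\mu$ be the probability measure on $\mathbb{R}^d$ given by $\mathrm{d}\mu(x)=\rho(|x|)\,\mathrm{d}x$, where $\rho:[0,\infty)\to(0,\infty)$ is continuous. Let $A\subset\mathbb{R}^d$ be a bounded closed convex set containing the origin $0$. Then for every closed ball $B$ centered at the origin, $$\mu(A\cap B)\ge \mu(A)\,\mu(B).$$
   Context: $|x|$ denotes the Euclidean norm on $\mathbb{R}^d$. The set $A$ is not assumed to be symmetric. In particular the conclusion applies to the standard Gaussian measure $\gamma_d$. *)

(* Defs.v *)
From HB Require Import structures.
From mathcomp Require Import all_boot all_order all_algebra.
From mathcomp Require Import all_classical all_reals all_analysis.
Set Implicit Arguments. Unset Strict Implicit. Unset Printing Implicit Defensive.
Import Order.TTheory GRing.Theory Num.Theory.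
Import numFieldNormedType.Exports.
Local Open Scope classical_set_scope.
Local Open Scope ring_scope.

Definition eucl_norm (R : realType) (d : nat) (x : 'rV[R]_d) : R :=
  Num.sqrt (\sum_(i < d) x ord0 i ^+ 2).

(* R^d equipped with its Borel sigma-algebra (generated by the open sets of
   the product topology, i.e. the usual topology of R^d). *)
Definition Rd (R : realType) (d : nat) :=
  g_sigma_algebraType (@open 'rV[R]_d).

Definition box (R : realType) (d : nat) (a b : 'rV[R]_d) : set 'rV[R]_d :=
  [set x | forall i : 'I_d, a ord0 i <= x ord0 i <= b ord0 i].

(* lam is the d-dimensional Lebesgue measure (on Borel sets): it gives every
   closed box its volume; this characterizes Lebesgue measure on the Borel
   sigma-algebra. *)
Definition is_lebesgue_Rd (R : realType) (d : nat)
  (lam : {measure set (Rd R d) -> \bar R}) : Prop :=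
  forall a b : 'rV[R]_d, (forall i : 'I_d, a ord0 i <= b ord0 i) ->
    lam (box a b) = (\prod_(i < d) (b ord0 i - a ord0 i))%:E.

Definition cball0 (R : realType) (d : nat) (r : R) : set 'rV[R]_d :=
  [set x | eucl_norm x <= r].

(* Main.v *)
(* Let B be the closed ball of radius r > 0 and let C be the cone of the
   directions in which the segment from 0 to the sphere of radius r stays in A.
   Since A is star-shaped at 0, C `&` B is contained in A, and A `\` B is
   contained in C. Dilation invariance of Lebesgue measure makes the radial
   distribution of the restriction of mu to C proportional to that of mu, so
   mu (C `&` B) = mu C * mu B. With q = mu B and k = mu C this gives
   k q <= mu (A `&` B) and mu (A `\` B) <= k (1 - q), whence the inequality,
   without polar coordinates. *)
Require Import Defs.
From HB Require Import structures.
From mathcomp Require Import all_boot all_order all_algebra.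
From mathcomp Require Import all_classical all_reals all_analysis.
From mathcomp Require Import measurable_realfun lra.
Import Order.TTheory GRing.Theory Num.Theory.
Import numFieldNormedType.Exports.
Local Open Scope classical_set_scope.
Local Open Scope ring_scope.

(** * Continuity and homogeneity of the Euclidean norm, and its comparison with coordinates *)

Section EuclideanNorm.
Context {R : realType} {d : nat}.
Implicit Types x : 'rV[R]_d.

Lemma eucl_norm_ge0 x : 0 <= eucl_norm x.
Proof. exact: sqrtr_ge0. Qed.

Lemma eucl_normZ (c : R) x : 0 <= c -> eucl_norm (c *: x) = c * eucl_norm x.
Proof.
move=> c0; rewrite /eucl_norm.
under eq_bigr do rewrite mxE exprMn.
by rewrite -mulr_sumr sqrtrM ?sqr_ge0// sqrtr_sqr ger0_norm.
Qed.

Lemma eucl_norm_continuous : continuous (@eucl_norm R d).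
Proof.
have cs : continuous (fun y : 'rV[R]_d => \sum_(i < d) y ord0 i ^+ 2).
  apply: continuous_big => [|i _ x]; first exact: add_continuous.
  apply: (@continuous_comp _ _ _ (fun y : 'rV[R]_d => y ord0 i) (@GRing.exp R ^~ 2)).
    exact: coord_continuous.
  exact: exprn_continuous.
by move=> x; apply: continuous_comp; [exact: cs|exact: sqrt_continuous].
Qed.

Lemma abs_coord_le_eucl_norm x i : `|x ord0 i| <= eucl_norm x.
Proof.
rewrite -sqrtr_sqr ler_wsqrtr// (bigD1 i)//= lerDl.
by apply: sumr_ge0 => j _; exact: sqr_ge0.
Qed.

(** Each square is at most [d.+1%:R^-1], so the sum of squares is at most d/(d+1) < 1. This puts a
    small cube inside the open unit ball. *)
Lemma eucl_norm_lt1 x :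
  (forall i, `|x ord0 i| <= d.+1%:R^-1) -> eucl_norm x < 1.
Proof.
move=> xd; rewrite -[1]sqrtr1 ltr_sqrt//.
apply: (@le_lt_trans _ _ (\sum_(i < d) d.+1%:R^-1)).
  apply: ler_sum => i _; rewrite -real_normK ?num_real// expr2.
  rewrite -[leRHS]mulr1 ler_pM//; apply: (le_trans (xd i)).
  by rewrite invf_le1 ?ler1n.
by rewrite sumr_const card_ord -[_ *+ d]mulr_natl ltr_pdivrMr// mul1r ltr_nat.
Qed.

End EuclideanNorm.

(** * Closed boxes as a generating pi-system of the Borel sets *)

Section BorelBoxes.
Context {R : realType} {d : nat}.

Definition boxes : set (set 'rV[R]_d) :=
  [set S | exists a b : 'rV[R]_d, S = box a b].

Lemma boxes_setI_closed : setI_closed boxes.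
Proof.
move=> _ _ [a [b ->]] [a' [b' ->]].
exists (\row_i Num.max (a ord0 i) (a' ord0 i)), (\row_i Num.min (b ord0 i) (b' ord0 i)).
apply/seteqP; split=> x /=.
  move=> [xab xab'] i; rewrite !mxE ge_max le_min.
  by case/andP: (xab i) => -> ->; case/andP: (xab' i) => -> ->.
move=> h; split=> i; move: (h i); rewrite !mxE ge_max le_min.
  by move=> /andP[/andP[-> _] /andP[-> _]].
by move=> /andP[/andP[_ ->] /andP[_ ->]].
Qed.

(** [is_lebesgue_Rd] prescribes volumes for ordered corners only; all other boxes are handled by
    emptiness. *)
Lemma box_eq0 (a b : 'rV[R]_d) :
  ~ (forall i, a ord0 i <= b ord0 i) -> box a b = set0.
Proof.
move=> nab; rewrite -subset0 => x xab; apply: nab => i.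
by have /andP[] := xab i; exact: le_trans.
Qed.

Lemma box_closed (a b : 'rV[R]_d) : closed (box a b).
Proof.
have -> : box a b = \bigcap_(i in [set: 'I_d])
    ((fun x : 'rV[R]_d => x ord0 i) @^-1` `[a ord0 i, b ord0 i]).
  apply/seteqP; split=> x /= h i; first by move=> _; rewrite /= in_itv /=; exact: h.
  by have := h i I; rewrite /= in_itv.
apply: closed_bigI => i _; apply: closed_comp => [x _|]; first exact: coord_continuous.
exact: interval_closed.
Qed.

(** An open set is the union of the boxes with rational corners that it contains, and there are
    countably many of these. *)
Lemma open_sub_boxes (U : set 'rV[R]_d) : open U -> <<s boxes >> U.
Proof.
move=> oU.
pose F (ab : 'rV[rat]_d * 'rV[rat]_d) : set 'rV[R]_d :=
  let B := box (map_mx ratr ab.1) (map_mx ratr ab.2) in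
  if `[< B `<=` U >] then B else set0.
have -> : U = \bigcup_ab F ab.
  apply/seteqP; split=> [x Ux|x [ab _]]; last first.
    by rewrite /F; case: asboolP => // BU /BU.
  have /nbhs_ballP[e /= e0 xeU] := open_nbhs_nbhs (conj oU Ux).
  have lo (i : 'I_d) : exists q : rat, ratr q \in `]x ord0 i - e, x ord0 i[.
    by apply: rat_in_itvoo; rewrite ltrBlDr ltrDl.
  have hi (i : 'I_d) : exists q : rat, ratr q \in `]x ord0 i, x ord0 i + e[.
    by apply: rat_in_itvoo; rewrite ltrDl.
  have [a alo] := choice lo.
  have [b bhi] := choice hi.
  exists (\row_i a i, \row_i b i) => //; rewrite /F; case: asboolP => [_ i|[]] /=.
    rewrite !mxE; move: (alo i) (bhi i); rewrite !in_itv /=.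
    by move=> /andP[_ /ltW ->] /andP[/ltW -> _].
  (* Balls of ['rV[R]_d] are tested entry by entry, so coordinatewise bounds within [e] suffice. *)
  move=> y yab; apply: xeU; split=> // i j; rewrite (ord1 i).
  have := yab j; rewrite !mxE; move: (alo j) (bhi j); rewrite !in_itv /=.
  move=> /andP[? _] /andP[_ ?] /andP[? ?].
  by rewrite /ball /= ltr_distlC; lra.
apply: (@countable_bigcupT_measurable _ (g_sigma_algebraType boxes)).
  exact: countableP.
move=> ab; rewrite /F; case: asboolP => _; last exact: measurable0.
by apply: sub_sigma_algebra; exists (map_mx ratr ab.1), (map_mx ratr ab.2).
Qed.

Lemma measurable_open (U : set 'rV[R]_d) : open U -> measurable (U : set (Rd R d)).
Proof. exact: sub_sigma_algebra. Qed.

Lemma measurable_closed (U : set 'rV[R]_d) :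
  closed U -> measurable (U : set (Rd R d)).
Proof.
move=> cU; rewrite -[U]setCK; apply: measurableC; apply: measurable_open.
exact: closed_openC.
Qed.

Lemma measurable_box (a b : 'rV[R]_d) : measurable (box a b : set (Rd R d)).
Proof. by apply: measurable_closed; exact: box_closed. Qed.

Lemma Rd_measurableE : @measurable _ (Rd R d) = <<s boxes >>.
Proof.
apply/seteqP; split; apply: smallest_sub; try exact: smallest_sigma_algebra.
  exact: open_sub_boxes.
by move=> _ [a [b ->]]; exact: measurable_box.
Qed.

Lemma measurable_fun_continuous (f : 'rV[R]_d -> R) :
  continuous f -> measurable_fun setT (f : Rd R d -> R).
Proof.
move=> /continuousP cf; apply: (measurability _ (RGenOpens.measurableE R)).
move=> _ [_ [a [b ->] <-]]; rewrite setTI.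
by apply: measurable_open; apply: cf; exact: interval_open.
Qed.

Lemma measurable_fun_scale (s : R) :
  measurable_fun setT ((fun x => s *: x) : Rd R d -> Rd R d).
Proof.
apply: (@measurability _ _ (Rd R d) (Rd R d) _ _ (@open 'rV[R]_d)) => //.
move=> _ [U oU <-]; rewrite setTI.
apply: measurable_open; apply: open_comp oU => x _.
exact: scaler_continuous.
Qed.

End BorelBoxes.

(** Split [E] along [D]: the part outside [D] is null for the restricted measure, and on [D] the two
    measures agree. *)
Lemma ge0_integral_mrestr {d} {T : measurableType d} {R : realType}
    (mu : {measure set T -> \bar R}) (D E : set T) (mD : measurable D)
    (f : T -> \bar R) :
  measurable E -> measurable_fun E f -> (forall x, E x -> 0 <= f x)%E ->
  (\int[mrestr mu mD]_(x in E) f x = \int[mu]_(x in D `&` E) f x)%E.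
Proof.
move=> mE mf f0; have mDE := measurableI _ _ mD mE.
have mED := measurableD mE mD.
have EDE : (D `&` E) `|` (E `\` D) = E by rewrite setIC setUIDK.
rewrite -[in LHS]EDE ge0_integral_setU ?EDE//; last first.
  by apply/disj_set2P; rewrite -subset0 => x [[Dx _] []].
rewrite [X in (_ + X)%E]null_set_integral//=.
- rewrite adde0; apply: eq_measure_integral => F mF FDE /=.
  by rewrite /mrestr (setIidl (subset_trans FDE _))//; exact: subIsetl.
- exact: measurable_funS mf.
- by rewrite /mrestr setDKI measure0.
Qed.

(** * Scaling of Lebesgue measure and the radial distribution on cones *)

Section LebesgueDilation.
Context {R : realType} {d : nat} {lam : {measure set (Rd R d) -> \bar R}}.
Hypothesis hlam : is_lebesgue_Rd lam.

Lemma lebesgue_box_lty (a b : 'rV[R]_d) : (lam (box a b) < +oo)%E.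
Proof.
have [ab|nab] := pselect (forall i, a ord0 i <= b ord0 i).
  by rewrite hlam// ltry.
by rewrite box_eq0// measure0.
Qed.

(** Both sides are measures in [S], the right one being a scaled pushforward. They agree on boxes,
    and cubes of finite volume exhaust the space, so uniqueness of measures applies. *)
Lemma lebesgue_dilation (s : R) (S : set (Rd R d)) : 0 < s -> measurable S ->
  lam S = ((s ^+ d)%:E * lam [set x : 'rV[R]_d | S (s *: x)])%E.
Proof.
move=> s0 mS; have sd0 : 0 <= s ^+ d by rewrite exprn_ge0// ltW.
pose m2 := mscale (NngNum sd0)
  (measure_function_pushforward__canonical__measure_function_Measure lam
     (measurable_fun_scale s)).
apply: (@measure_unique _ R (Rd R d) boxes
  (fun n => box (const_mx (- n%:R)) (const_mx n%:R)) _ _ _ _ lam m2) => //.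
- exact: Rd_measurableE.
- exact: boxes_setI_closed.
- by move=> n; eexists; eexists; reflexivity.
- apply/seteqP; split=> // x _.
  exists (Num.truncn (eucl_norm x)).+1 => // i; rewrite !mxE -ler_norml.
  by rewrite (le_trans (abs_coord_le_eucl_norm _ _))// ltW// truncnS_gt.
- move=> _ [a [b ->]].
  (* The preimage of a box under dilation is the box with corners divided by [s]; its volume loses
     the factor [s ^+ d]. *)
  transitivity ((s ^+ d)%:E * lam (box (s^-1 *: a) (s^-1 *: b)))%E; last first.
    congr (_ * lam _)%E; apply/seteqP; split=> x /= + i => /(_ i);
      by rewrite !mxE ![s^-1 * _]mulrC ler_pdivrMr// ler_pdivlMr// [s * _]mulrC.
  have [ab|nab] := pselect (forall i, a ord0 i <= b ord0 i).
    rewrite !hlam// => [|i]; last by rewrite !mxE ler_pM2l// invr_gt0.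
    rewrite -EFinM; congr (_%:E).
    under [in RHS]eq_bigr do rewrite !mxE -mulrBr.
    rewrite big_split/= prodr_const card_ord mulrA -exprMn mulfV ?gt_eqF//.
    by rewrite expr1n mul1r.
  rewrite !box_eq0 ?measure0 ?mule0//; apply: contra_not nab => ab i.
  by have := ab i; rewrite !mxE ler_pM2l// invr_gt0.
- by move=> n; exact: lebesgue_box_lty.
Qed.

(** Open balls are the norm preimages of the rays []-oo, t[], which generate the Borel sets of the
    line. *)
Definition oball0 (t : R) : set (Rd R d) := [set x : 'rV[R]_d | eucl_norm x < t].

Lemma measurable_eucl_norm : measurable_fun setT (@eucl_norm R d : Rd R d -> R).
Proof. by apply: measurable_fun_continuous; exact: eucl_norm_continuous. Qed.

Lemma measurable_preimage_eucl_norm (E : set R) : measurable E ->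
  measurable (@eucl_norm R d @^-1` E : set (Rd R d)).
Proof. by move=> mE; rewrite -[X in measurable X]setTI; exact: measurable_eucl_norm. Qed.

Lemma measurable_oball0 t : measurable (oball0 t).
Proof.
have -> : oball0 t = @eucl_norm R d @^-1` `]-oo, t[.
  by apply/seteqP; split=> x; rewrite /= in_itv.
exact: measurable_preimage_eucl_norm.
Qed.

Lemma lebesgue_oball0_lty t : (lam (oball0 t) < +oo)%E.
Proof.
apply: le_lt_trans (lebesgue_box_lty (const_mx (- t)) (const_mx t)).
apply: le_measure; rewrite ?inE; [exact: measurable_oball0|exact: measurable_box|].
move=> x /= xt i; rewrite !mxE -ler_norml.
exact/(le_trans (abs_coord_le_eucl_norm _ _))/ltW.
Qed.

Lemma fin_num_lebesgueI_oball0 (C : set (Rd R d)) t :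
  measurable C -> lam (C `&` oball0 t) \is a fin_num.
Proof.
move=> mC; have mt := measurable_oball0 t; have mCt := measurableI _ _ mC mt.
rewrite ge0_fin_numE// (le_lt_trans _ (lebesgue_oball0_lty t))//.
by apply: le_measure; rewrite ?inE.
Qed.

(** The ball contains a nondegenerate cube. Positivity later allows cancelling this volume. *)
Lemma lebesgue_oball0_gt0 : (0 < lam (oball0 1))%E.
Proof.
apply: (@lt_le_trans _ _ (lam (box (0 : 'rV[R]_d) (const_mx d.+1%:R^-1)))).
  rewrite hlam => [|i]; last by rewrite !mxE invr_ge0.
  by rewrite lte_fin prodr_gt0// => i _; rewrite !mxE subr0 invr_gt0.
apply: le_measure; rewrite ?inE; [exact: measurable_box|exact: measurable_oball0|].
move=> x /= xb; apply: eucl_norm_lt1 => i.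
by have := xb i; rewrite !mxE => /andP[/ger0_norm ->].
Qed.

(** The law of the radius on [D]: it turns integrals of radial functions into integrals on the line,
    in place of polar coordinates. *)
Definition radial_measure {D : set (Rd R d)} (mD : measurable D) :
    {measure set R -> \bar R} :=
  measure_function_pushforward__canonical__measure_function_Measure
    (mrestr lam mD) measurable_eucl_norm.

Lemma radial_measureE (D : set (Rd R d)) (mD : measurable D) (E : set R) :
  radial_measure mD E = lam (D `&` @eucl_norm R d @^-1` E).
Proof. by rewrite /radial_measure /= /pushforward /mrestr setIC. Qed.

Lemma ge0_integral_radial_measure (D : set (Rd R d)) (mD : measurable D)
    (E : set R) (f : R -> R) :
  measurable E -> measurable_fun E f -> (forall t, E t -> 0 <= f t) ->
  (\int[radial_measure mD]_(t in E) (f t)%:E =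
   \int[lam]_(x in D `&` @eucl_norm R d @^-1` E) (f (eucl_norm (x : 'rV[R]_d)))%:E)%E.
Proof.
move=> mE mf f0; have mfE := (measurable_EFinP _ _).2 mf.
rewrite ge0_integral_pushforward//=; first last.
- by move=> t /[!inE] /f0; rewrite lee_fin.
- exact: measurable_eucl_norm.
rewrite ge0_integral_mrestr//=.
- exact: measurable_preimage_eucl_norm.
- apply: (@measurable_comp _ _ _ _ _ _ E (EFin \o f)) => //.
    by move=> _ [x Ex <-].
  by apply: measurable_funTS; exact: measurable_eucl_norm.
- by move=> x /f0; rewrite lee_fin.
Qed.

(** Only positive factors occur, so the whole space and cones without apex both qualify. *)
Definition is_cone (C : set (Rd R d)) :=
  forall (s : R) (x : 'rV[R]_d), 0 < s -> C (s *: x) <-> C x.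

Lemma lebesgue_coneI_oball0 (C : set (Rd R d)) (t : R) :
  measurable C -> is_cone C -> 0 < t ->
  lam (C `&` oball0 t) = ((t ^+ d)%:E * lam (C `&` oball0 1))%E.
Proof.
move=> mC C_cone t0; rewrite (lebesgue_dilation t _ t0); last first.
  by apply: measurableI => //; exact: measurable_oball0.
congr (_ * lam _)%E; apply/seteqP; split=> x /=;
  rewrite /oball0 /= eucl_normZ ?ltW// gtr_pMr//; by rewrite C_cone.
Qed.

(** [mscale] takes a nonnegative real factor; [fine] loses nothing for measurable [C], the volume
    being finite. *)
Definition unit_volume (C : set (Rd R d)) : {nonneg R} :=
  NngNum (fine_ge0 (measure_ge0 lam (C `&` oball0 1))).

Lemma unit_volumeE (C : set (Rd R d)) :
  measurable C -> (unit_volume C)%:num%:E = lam (C `&` oball0 1).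
Proof. by move=> mC; rewrite fineK// fin_num_lebesgueI_oball0. Qed.

(* By dilation, the mass of [`]-oo, t[] is proportional to [t ^+ d] on both sides. *)
Lemma radial_measure_cone (C : set (Rd R d)) (mC : measurable C) (E : set R) :
  is_cone C -> measurable E ->
  mscale (unit_volume setT) (radial_measure mC) E =
  mscale (unit_volume C) (radial_measure measurableT) E.
Proof.
move=> C_cone mE.
have oE t : @eucl_norm R d @^-1` `]-oo, t[ = oball0 t.
  by apply/seteqP; split=> x; rewrite /= in_itv.
have mscaleE (k : {nonneg R}) (m : {measure set R -> \bar R}) F :
  (mscale k m : {measure set R -> \bar R}) F = (k%:num%:E * m F)%E by [].
apply: (@measure_unique _ R R (@RGenInftyO.G R)
  (fun n : nat => `]-oo, n%:R[%classic)) => //.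
- exact: RGenInftyO.measurableE.
- move=> _ _ [x ->] [y ->]; exists (Num.min x y).
  by apply/seteqP; split=> z /=; rewrite !in_itv /= lt_min; move/andP.
- by move=> n; exists n%:R.
- apply/seteqP; split=> // x _; exists (Num.truncn x).+1 => //=.
  by rewrite in_itv /= truncnS_gt.
- move=> _ [t ->]; rewrite !mscaleE !unit_volumeE// !radial_measureE oE.
  (* Dilation by [t] needs [t] positive; otherwise the open ball is empty and both sides vanish. *)
  have [t0|t0] := ltP 0 t.
    rewrite (lebesgue_coneI_oball0 _ _ mC)//.
    rewrite (lebesgue_coneI_oball0 _ t measurableT)//.
    by rewrite muleCA [RHS]muleCA [X in (_ * X)%E]muleC.
  have -> : oball0 t = set0.
    rewrite -subset0 => x /= xt.
    by have := lt_le_trans xt t0; rewrite ltNge eucl_norm_ge0.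
  by rewrite !setI0 !measure0 !mule0.
- move=> n; rewrite mscaleE lte_mul_pinfty//.
  by rewrite radial_measureE oE -ge0_fin_numE// fin_num_lebesgueI_oball0.
Qed.

(** Integrates [f] against the two proportional radial laws. The cross-multiplied form avoids
    quotients of extended reals. *)
Lemma ge0_integral_cone_radial (C : set (Rd R d)) (E : set R) (f : R -> R) :
  measurable C -> is_cone C ->
  measurable E -> measurable_fun E f -> (forall t, E t -> 0 <= f t) ->
  (lam (oball0 1) *
     \int[lam]_(x in C `&` @eucl_norm R d @^-1` E) (f (eucl_norm (x : 'rV[R]_d)))%:E =
   lam (C `&` oball0 1) *
     \int[lam]_(x in @eucl_norm R d @^-1` E) (f (eucl_norm (x : 'rV[R]_d)))%:E)%E.
Proof.
move=> mC C_cone mE mf f0.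
have f0E t : E t -> (0 <= (f t)%:E)%E by rewrite lee_fin; exact: f0.
have mfE := (measurable_EFinP _ _).2 mf.
rewrite -[X in (_ = _ * integral _ X _)%E]setTI.
rewrite -(ge0_integral_radial_measure _ mC)//.
rewrite -(ge0_integral_radial_measure _ measurableT)//.
rewrite -[X in lam X]setTI -!unit_volumeE// -!ge0_integral_mscale//.
by apply: eq_measure_integral => F mF _; exact: radial_measure_cone.
Qed.

End LebesgueDilation.

(** * The cone spanned by the points of [A] on the sphere of radius [r] *)

Section DirectionCone.
Context {R : realType} {d : nat} (A : set 'rV[R]_d) (r : R).
Hypothesis r0 : 0 < r.

(** A point is tested through its projection to the sphere; the origin has no direction and is
    excluded. *)
Definition direction_cone : set 'rV[R]_d :=
  [set x | 0 < eucl_norm x /\ A ((r / eucl_norm x) *: x)].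

Lemma direction_cone_is_cone : is_cone direction_cone.
Proof.
move=> s x s0; rewrite /direction_cone /= eucl_normZ ?ltW// pmulr_rgt0//.
have -> : (r / (s * eucl_norm x)) *: (s *: x) = (r / eucl_norm x) *: x.
  by rewrite scalerA invfM [s^-1 * _]mulrC mulrA divfK ?gt_eqF//.
by [].
Qed.

(** Radial projection is continuous off the origin, so the nonzero points projected outside the
    closed set [A] form an open set; the cone is its complement among nonzero points. *)
Lemma measurable_direction_cone :
  closed A -> measurable (direction_cone : set (Rd R d)).
Proof.
move=> cA; have nc := @eucl_norm_continuous R d.
have mpos : measurable (@eucl_norm R d @^-1` `]0, +oo[ : set (Rd R d)).
  exact: measurable_preimage_eucl_norm.
suff oD : open [set x : 'rV[R]_d | 0 < eucl_norm x /\ ~ A ((r / eucl_norm x) *: x)].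
  have -> : direction_cone = (@eucl_norm R d @^-1` `]0, +oo[) `\`
      [set x : 'rV[R]_d | 0 < eucl_norm x /\ ~ A ((r / eucl_norm x) *: x)].
    apply/seteqP; split=> x; rewrite /= in_itv /= andbT.
      by move=> [x0 Ax]; split=> // -[_].
    by move=> [x0 nA]; split=> //; apply: contrapT => nAx; exact: nA.
  by apply: measurableD => //; exact: measurable_open.
rewrite openE => x [x0 nAx]; rewrite /interior.
have nbA : nbhs ((r / eucl_norm x) *: x) (~` A).
  by apply: open_nbhs_nbhs; split => //; exact: closed_openC.
have cf (F : set_system 'rV[R]_d) : Filter F ->
    eucl_norm y @[y --> F] --> eucl_norm x -> y @[y --> F] --> x ->
    (r / eucl_norm y) *: y @[y --> F] --> (r / eucl_norm x) *: x.
  move=> FF nF idF; apply: cvgZ => //.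
  by apply: cvgM; [exact: cvg_cst|apply: cvgV => //; rewrite gt_eqF].
apply: filterI; last exact: (cf (nbhs x) _ (nc x) cvg_id) nbA.
exact: (cvgr_gt _ (nc x)).
Qed.

Hypotheses (A_convex : convex_set (A : set (convex_lmodType 'rV[R]_d))) (A0 : A 0).

Lemma convex_star (t : R) (x : 'rV[R]_d) : 0 <= t <= 1 -> A x -> A (t *: x).
Proof.
move=> /andP[t0 t1] Ax.
have /set_mem : (t *: x + (1 - t) *: 0 : 'rV[R]_d) \in A.
  by apply: (A_convex x 0 (Itv01 t0 t1)); exact: mem_set.
by rewrite scaler0 addr0.
Qed.

(** Inside the ball, [x] is the contraction by [eucl_norm x / r] of its projection, which lies in
    [A]. *)
Lemma direction_coneI_cball0 :
  direction_cone `&` cball0 (d:=d) r `<=` A `&` cball0 (d:=d) r.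
Proof.
move=> x [[x0 Ax] xr]; split=> //.
have -> : x = (eucl_norm x / r) *: ((r / eucl_norm x) *: x).
  by rewrite scalerA mulrA divfK ?gt_eqF// divff ?scale1r ?gt_eqF.
by apply: convex_star => //; rewrite divr_ge0 ?(ltW x0) ?(ltW r0)//= ler_pdivrMr// mul1r.
Qed.

(** Outside the ball the roles are exchanged: the projection is a contraction of [x]. *)
Lemma setD_cball0_direction_cone :
  A `\` cball0 (d:=d) r `<=` direction_cone `\` cball0 (d:=d) r.
Proof.
move=> x [Ax /= xr]; split=> //.
have rx : r < eucl_norm x by rewrite ltNge; exact/negP.
have x0 := lt_trans r0 rx; split=> //.
apply: convex_star => //.
by rewrite divr_ge0 ?(ltW x0) ?(ltW r0)//= ler_pdivrMr// mul1r ltW.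
Qed.

End DirectionCone.

(** * Independence of direction and radius under a radial density *)

Section RadialDensity.
Context {R : realType} {d : nat} {lam : {measure set (Rd R d) -> \bar R}}.
Hypothesis hlam : is_lebesgue_Rd lam.
Context {rho : R -> R} {mu : probability (Rd R d) R}.
Hypotheses (hrho_cont : {within `[0, +oo[, continuous rho})
  (hrho_pos : forall t : R, 0 <= t -> 0 < rho t)
  (hmu : forall S : set (Rd R d), measurable S ->
     mu S = (\int[lam]_(x in S) (rho (eucl_norm (x : 'rV[R]_d)))%:E)%E).

Lemma measurable_density : measurable_fun (`[0, +oo[ : set R) rho.
Proof. by apply: subspace_continuous_measurable_fun. Qed.

(** The interval starts at [0] to stay in the half-line where [rho] is continuous and positive. *)
Lemma cball0E (r : R) : cball0 (d:=d) r = @eucl_norm R d @^-1` `[0, r].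
Proof. by apply/seteqP; split=> x; rewrite /= in_itv /= eucl_norm_ge0. Qed.

Lemma measurable_cball0 (r : R) : measurable (cball0 (d:=d) r : set (Rd R d)).
Proof. by rewrite cball0E; exact: measurable_preimage_eucl_norm. Qed.

(** The ball is the degenerate box at the origin; as [0 < d], its volume is a product with a zero
    factor. *)
Lemma cball0_0_null : (0 < d)%N -> mu (cball0 (d:=d) 0 : set (Rd R d)) = 0%E.
Proof.
move=> d0; rewrite hmu ?null_set_integral//; try exact: measurable_cball0.
- apply/measurable_EFinP.
  apply: (@measurable_comp _ _ _ _ _ _ (`[0, +oo[ : set R) rho) => //.
  + by move=> _ [x _ <-]; rewrite /= in_itv /= eucl_norm_ge0.
  + exact: measurable_density.
  + by apply: measurable_funTS; exact: measurable_eucl_norm.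
- have -> : cball0 (d:=d) 0 = box (0 : 'rV[R]_d) 0.
    apply/seteqP; split=> x /= xb.
      move=> i; rewrite !mxE; have := abs_coord_le_eucl_norm x i.
      move=> /le_trans /(_ xb); rewrite normr_le0 => /eqP ->.
      by rewrite lexx.
    have -> : x = 0.
      apply/rowP => i; have := xb i; rewrite !mxE => /andP[x0 x0'].
      by apply/eqP; rewrite eq_le x0 x0'.
    by rewrite /cball0 /= -(scale0r 0) eucl_normZ ?mul0r.
  rewrite hlam => [|i]; last exact: lexx.
  by congr (_%:E); rewrite (bigD1 (Ordinal d0))//= subrr mul0r.
Qed.

Lemma cone_preimage_eucl_norm (C : set (Rd R d)) (E : set R) :
  measurable C -> is_cone C -> measurable E -> E `<=` `[0, +oo[ ->
  (lam (oball0 1) * mu (C `&` @eucl_norm R d @^-1` E) =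
   lam (C `&` oball0 1) * mu (@eucl_norm R d @^-1` E))%E.
Proof.
move=> mC C_cone mE E0; have mnE := measurable_preimage_eucl_norm _ mE.
rewrite !hmu//; last exact: measurableI.
apply: ge0_integral_cone_radial => //.
  exact: measurable_funS measurable_density.
by move=> t /E0; rewrite /= in_itv /= andbT => /hrho_pos /ltW.
Qed.

Lemma cone_cball0_independent (C : set (Rd R d)) (r : R) :
  measurable C -> is_cone C ->
  (mu (C `&` cball0 (d:=d) r) = mu C * mu (cball0 (d:=d) r : set (Rd R d)))%E.
Proof.
move=> mC C_cone.
have eT : @eucl_norm R d @^-1` `[0, +oo[ = setT.
  by apply/seteqP; split=> // x _; rewrite /= in_itv /= eucl_norm_ge0.
(* On the full half-line, where [mu] has mass 1, proportionality identifies [mu C] as the volume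
   ratio of the cone in the unit ball. *)
have /= muC :=
  @cone_preimage_eucl_norm C `[0, +oo[ mC C_cone (measurable_itv _) (fun _ => id).
rewrite eT setIT probability_setT mule1 in muC.
have b0 := lebesgue_oball0_gt0 hlam.
have bfin : lam (oball0 1) \is a fin_num.
  by rewrite ge0_fin_numE// (lebesgue_oball0_lty hlam).
(* Multiply by the finite positive volume of the unit ball, which leaves proportionality on
   [[0, r]]. *)
apply: (inc_inj (lee_pmul2l bfin b0)); rewrite muleA muC cball0E.
apply: cone_preimage_eucl_norm => // t; rewrite /= !in_itv /= andbT.
by case/andP.
Qed.

End RadialDensity.

(** * Comparison of [A] with its cone inside and outside the ball *)

Theorem theorem1p1 (R : realType) (d : nat) (hd : (0 < d)%N)
  (lam : {measure set (Rd R d) -> \bar R}) (hlam : is_lebesgue_Rd lam)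
  (rho : R -> R)
  (hrho_cont : {within `[0, +oo[, continuous rho})
  (hrho_pos : forall t : R, 0 <= t -> 0 < rho t)
  (mu : probability (Rd R d) R)
  (hmu : forall S : set (Rd R d), measurable S ->
     mu S = (\int[lam]_(x in S) (rho (eucl_norm (x : 'rV[R]_d)))%:E)%E)
  (A : set 'rV[R]_d)
  (hA_bdd : bounded_set A) (hA_closed : closed A)
  (hA_convex : convex_set (A : set (convex_lmodType 'rV[R]_d)))
  (hA0 : A 0)
  (r : R) (hr : 0 <= r) :
  (mu (A : set (Rd R d)) * mu (cball0 (d:=d) r : set (Rd R d))
     <= mu ((A `&` cball0 (d:=d) r) : set (Rd R d)))%E.
Proof.
have mA : measurable (A : set (Rd R d)) by exact: measurable_closed.
have mB := @measurable_cball0 R d r.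
(* Projection to the sphere needs a positive radius; at radius 0 the ball is null. *)
move: hr; rewrite le_eqVlt => /predU1P[r0|r0].
  rewrite -r0 (cball0_0_null hlam hrho_cont hmu hd) mule0.
  exact: measure_ge0.
set B : set (Rd R d) := cball0 (d:=d) r in mB *.
have mC := measurable_direction_cone A r hA_closed.
set C : set (Rd R d) := direction_cone A r in mC.
have muE (S : set (Rd R d)) : measurable S -> mu S = (fine (mu S))%:E.
  by move=> mS; rewrite fineK// fin_num_measure.
have muU (S : set (Rd R d)) : measurable S ->
    fine (mu S) = fine (mu (S `&` B)) + fine (mu (S `\` B)).
  move=> mS; rewrite -[in LHS](setUIDK S B) measureU//.
  - by rewrite fineD// fin_num_measure//; [exact: measurableI|exact: measurableD].
  - exact: measurableI.
  - exact: measurableD.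
  - by rewrite -subset0 => x [[_ Bx] []].
have le_mu (S S' : set (Rd R d)) : measurable S -> measurable S' -> S `<=` S' ->
    fine (mu S) <= fine (mu S').
  move=> mS mS' SS'; rewrite fine_le ?fin_num_measure//.
  by apply: le_measure; rewrite ?inE.
have mAB := measurableI _ _ mA mB; have mCB := measurableI _ _ mC mB.
have hind : fine (mu (C `&` B)) = fine (mu C) * fine (mu B).
  rewrite (cone_cball0_independent hlam hrho_cont hrho_pos hmu)//.
    by rewrite fineM// fin_num_measure.
  exact: direction_cone_is_cone.
have hin := le_mu _ _ mCB mAB (direction_coneI_cball0 _ _ r0 hA_convex hA0).
have hout := le_mu _ _ (measurableD mA mB) (measurableD mC mB)
  (setD_cball0_direction_cone _ _ r0 hA_convex hA0).
have hA := muU A mA; have hC := muU C mC.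
have q0 : 0 <= fine (mu B) by exact/fine_ge0/measure_ge0.
have q1 : fine (mu B) <= 1.
  by rewrite -lee_fin -muE// probability_le1.
rewrite (muE A mA) (muE B mB) (muE (A `&` B) mAB) -EFinM lee_fin.
(* With q = mu B, weight the inner comparison by 1 - q and the outer one by q: in the sum the cone
   terms k q (1 - q) cancel, leaving (1 - q) mu (A [&] B) >= q mu (A [\] B). *)
have h1 : 0 <= (fine (mu (A `&` B)) - fine (mu (C `&` B))) * (1 - fine (mu B)).
  by rewrite mulr_ge0// subr_ge0.
have h2 : 0 <= (fine (mu (C `\` B)) - fine (mu (A `\` B))) * fine (mu B).
  by rewrite mulr_ge0// subr_ge0.
by move: h1 h2; rewrite hA; nra.
Qed.
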